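(* There is an absolute constant $c$ such that for every oriented tree $T$ of height $h$ with $1\le h\le 3$, with core $P_T$, there is a digraph $D_T$ with $|V_{D_T}|\le c\,|V_{P_T}|$ such that $(T,D_T)$ is a duality pair. In particular, since $|V_{P_T}|\le |V_T|$, $|V_{D_T}|\le c\,|V_T|$.
   Context: A homomorphism $G\to H$ of digraphs is a vertex map sending arcs to arcs. An oriented tree is an orientation of a (finite, undirected) tree. An ordered pair $(G,H)$ of digraphs is a duality pair if for every digraph $L$: $G\not\to L$ iff $L\to H$. A digraph is a core if it is not homomorphic to any proper subgraph of itself; the core of $G$ is a subgraph of $G$ that is a core and homomorphically equivalent to $G$. A connected digraph is balanced if every oriented cycle has equally many forward and backward arcs (oriented trees are balanced). For a connected balanced digraph, fix a vertex $x$ of in-degree $0$; the level of a vertex $v$ is the number of forward arcs minus backward arcs on any oriented path from $x$ to $v$ (normalized so the minimum level is $0$), and the height is the maximum level. *)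

(* Defs.v *)
From mathcomp Require Import all_boot.
Set Implicit Arguments. Unset Strict Implicit. Unset Printing Implicit Defensive.

Record digraph := Digraph { vert : finType; arc : rel vert }.

Definition hom_to (G H : digraph) : Prop :=
  exists f : vert G -> vert H, forall x y : vert G, arc x y -> arc (f x) (f y).

Definition uadj (G : digraph) : rel (vert G) := fun x y => arc x y || arc y x.

(* Oriented tree: orientation of a finite undirected tree, i.e. no loops,
   no pair of opposite arcs (so arcs = edges of the underlying simple graph),
   the underlying graph is nonempty and connected with |E| = |V| - 1. *)
Definition oriented_tree (G : digraph) : Prop :=
  [/\ 0 < #|vert G|,
      (forall x : vert G, ~~ arc x x),
      (forall x y : vert G, ~~ (arc x y && arc y x)),
      (forall x y, connect (@uadj G) x y)
    & #|[set p : vert G * vert G | arc p.1 p.2]| = #|vert G| - 1].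

Definition has_height (G : digraph) (h : nat) : Prop :=
  exists lv : vert G -> nat,
    [/\ (forall x y : vert G, arc x y -> lv y = (lv x).+1),
        (exists x, lv x = 0),
        (exists x, lv x = h)
      & (forall x, lv x <= h)].

(* G is a core: G is not homomorphic to any proper subgraph of itself.
   A subgraph is given by a vertex set S and an arc relation A contained in
   the arcs of G between vertices of S; it is proper if S misses a vertex
   or A misses an arc. *)
Definition is_core (G : digraph) : Prop :=
  ~ exists (S : {set vert G}) (A : rel (vert G)),
      [/\ (forall x y : vert G, A x y -> [&& arc x y, x \in S & y \in S]),
          (S != setT \/ exists x y : vert G, arc x y && ~~ A x y)
        & exists f : vert G -> vert G,
            (forall x, f x \in S) /\ (forall x y : vert G, arc x y -> A (f x) (f y))].

Definition core_of (P G : digraph) : Prop :=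
  [/\ is_core P,
      (exists f : vert P -> vert G,
          injective f /\ forall x y : vert P, arc x y -> arc (f x) (f y))
    & hom_to G P].

Definition duality_pair (G H : digraph) : Prop :=
  forall L : digraph, ~ hom_to G L <-> hom_to L H.

(* Main.v *)
From mathcomp Require Import all_boot.
From mathcomp Require Import zify.
Require Import Defs.

Set Implicit Arguments.
Unset Strict Implicit.
Unset Printing Implicit Defensive.

(** Up to homomorphic equivalence a connected digraph of height 1 or 2 is a
    directed path, and one of height 3 is a zigzag
    [w -> x_0 -> y_0 <- x_1 -> y_1 <- ... <- x_k -> y_k -> t] with [k] minimal:
    the vertices of levels 1 and 2 are sent to the zigzag according to their
    truncated distance, inside these two levels, from the vertices of level 1
    having an in-neighbour.  In an arbitrary digraph the same distance, now
    truncated at [k + 1], is a homomorphism to a digraph on [2k + 4] vertices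
    exactly when there is no zigzag.  Since a shortest zigzag in the core has
    distinct [x_i], the core has at least [k + 1] vertices. *)

(** * Zigzag walks and the truncated distance along them *)

Definition first_index (p : pred nat) (n : nat) : nat := find p (iota 0 n).

Lemma first_index_le (p : pred nat) n : first_index p n <= n.
Proof. by rewrite -{2}(size_iota 0 n) find_size. Qed.

Lemma first_indexP (p : pred nat) n : first_index p n < n -> p (first_index p n).
Proof.
move=> lt_n; have := nth_find 0 (a := p) (s := iota 0 n).
by rewrite has_find size_iota nth_iota // add0n; apply.
Qed.

Lemma first_index_min (p : pred nat) n i : p i -> first_index p n <= i.
Proof.
move=> pi; rewrite leqNgt; apply/negP => lt_i.
have lt_in : i < n by apply: leq_trans lt_i (first_index_le p n).
by have := before_find 0 lt_i; rewrite nth_iota // add0n pi.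
Qed.

Lemma first_index_none (p : pred nat) n :
  (forall i, i < n -> ~~ p i) -> first_index p n = n.
Proof.
move=> np; apply/eqP; rewrite eqn_leq first_index_le /= leqNgt.
by apply/negP => lt_n; have := np _ lt_n; rewrite first_indexP.
Qed.

(** [x] ends a walk [w -> x_0 -> y_0 <- x_1 -> ... <- x_i = x]; vertices may repeat, so
    homomorphisms preserve it. *)
Fixpoint zreach (G : digraph) (i : nat) (x : vert G) : bool :=
  if i is j.+1 then
    [exists x' : vert G, exists y : vert G, [&& zreach j x', arc x' y & arc x y]]
  else [exists w : vert G, arc w x].

Definition zreach_out (G : digraph) (i : nat) (y : vert G) : bool :=
  [exists x : vert G, zreach i x && arc x y].

Definition zigzag (G : digraph) (k : nat) : bool :=
  [exists y : vert G, zreach_out k y && [exists t : vert G, arc y t]].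

(** The default value [n] means that no walk of index below [n] reaches [x]. *)
Definition zrank (G : digraph) (n : nat) (x : vert G) : nat :=
  first_index (fun i => zreach i x) n.

Definition zrank_out (G : digraph) (n : nat) (y : vert G) : nat :=
  first_index (fun i => zreach_out i y) n.

Lemma zreachS (G : digraph) i (x' x y : vert G) :
  zreach i x' -> arc x' y -> arc x y -> zreach i.+1 x.
Proof. by move=> *; apply/existsP; exists x'; apply/existsP; exists y; apply/and3P. Qed.

Lemma zreach_arc (G : digraph) i (x y : vert G) :
  zreach i x -> arc x y -> zreach_out i y.
Proof. by move=> *; apply/existsP; exists x; apply/andP. Qed.

Lemma zreach_out_arc (G : digraph) i (x y : vert G) :
  zreach_out i y -> arc x y -> zreach i.+1 x.
Proof. by case/existsP=> x' /andP[]; apply: zreachS. Qed.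

Lemma zreach_out_zigzag (G : digraph) k (y t : vert G) :
  zreach_out k y -> arc y t -> zigzag G k.
Proof. by move=> *; apply/existsP; exists y; apply/andP; split=> //; apply/existsP; exists t. Qed.

Lemma zreach_zigzag (G : digraph) k (x y t : vert G) :
  zreach k x -> arc x y -> arc y t -> zigzag G k.
Proof. by move=> Sx xy; apply: zreach_out_zigzag (zreach_arc Sx xy). Qed.

Lemma zigzagP (G : digraph) k :
  reflect (exists x y t : vert G, [/\ zreach k x, arc x y & arc y t]) (zigzag G k).
Proof.
apply: (iffP existsP) => [[y /andP[/existsP[x /andP[? ?]] /existsP[t ?]]]|].
  by exists x, y, t.
by case=> x [y [t [Sx xy yt]]]; apply/existsP; apply: zreach_zigzag Sx xy yt.
Qed.

(** The idle step [x -> y <- x] lengthens a zigzag. *)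
Lemma zigzag_leq (G : digraph) i k : i <= k -> zigzag G i -> zigzag G k.
Proof.
move/subnK <-; elim: (k - i) => // n IHn /IHn /zigzagP[x [y [t [Sx xy yt]]]].
exact: zreach_zigzag (zreachS Sx xy xy) xy yt.
Qed.

Lemma zreach_hom (G H : digraph) (f : vert G -> vert H) :
  (forall x y : vert G, arc x y -> arc (f x) (f y)) ->
  forall i (x : vert G), zreach i x -> zreach i (f x).
Proof.
move=> fP; elim=> [|i IHi] x /existsP[w].
  by move/fP=> wx; apply/existsP; exists (f w).
by case/existsP=> y /and3P[/IHi Sw /fP wy /fP xy]; apply: zreachS Sw wy xy.
Qed.

Lemma zigzag_hom (G H : digraph) k : hom_to G H -> zigzag G k -> zigzag H k.
Proof.
case=> f fP /zigzagP[x [y [t [/(zreach_hom fP) Sx /fP xy /fP yt]]]].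
exact: zreach_zigzag Sx xy yt.
Qed.

(** A walk reaching [x] continues to [y], and one reaching [y] returns to [x] at the cost of one
    step; at the cutoff [n] both distances agree. *)
Lemma zrank_arc (G : digraph) n (x y : vert G) :
  arc x y ->
  zrank n x = zrank_out n y \/ zrank_out n y < n /\ zrank n x = (zrank_out n y).+1.
Proof.
move=> xy.
have le_out : zrank_out n y <= zrank n x.
  have := first_index_le (fun i => zreach i x) n; rewrite -/(zrank n x) leq_eqVlt.
  case/predU1P=> [-> | /first_indexP Sx]; first exact: first_index_le.
  exact: first_index_min (zreach_arc Sx xy).
have := first_index_le (fun i => zreach_out i y) n; rewrite -/(zrank_out n y) leq_eqVlt.
have := first_index_le (fun i => zreach i x) n; rewrite -/(zrank n x) => le_x.
case/predU1P=> [eq_n | lt_n]; first by left; lia.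
have : zrank n x <= (zrank_out n y).+1.
  exact: first_index_min (zreach_out_arc (first_indexP lt_n) xy).
lia.
Qed.

Lemma zrank0 (G : digraph) n (w x : vert G) : arc w x -> zrank n x = 0.
Proof.
move=> wx; apply/eqP; rewrite -leqn0.
by apply: (@first_index_min (fun i => zreach i x)); apply/existsP; exists w.
Qed.

Lemma zrank_pred (G : digraph) n i (x : vert G) :
  i.+1 < n -> zrank n x = i.+1 -> exists x' : vert G, zrank n x' = i.
Proof.
move=> lt_n eq_x.
have := @first_indexP (fun j => zreach j x) n; rewrite -/(zrank n x) eq_x => /(_ lt_n).
case/existsP=> x' /existsP[y /and3P[Sx' x'y xy]]; exists x'.
have le_i : zrank n x' <= i by apply: first_index_min Sx'.
have Srk : zreach (zrank n x') x'.
  exact: (@first_indexP (fun j => zreach j x')) (leq_ltn_trans le_i (ltnW lt_n)).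
have : zrank n x <= (zrank n x').+1 by apply: first_index_min (zreachS Srk x'y xy).
lia.
Qed.

(** The last [x] of a shortest zigzag has distance exactly [k], as a smaller one would give a
    shorter zigzag through the same [y] and [t]. Going back along shortest walks, the distance takes
    every value from [k] down to [0]. *)
Lemma shortest_zigzag_card (G : digraph) k :
  zigzag G k -> (forall i, i < k -> ~~ zigzag G i) -> k < #|vert G|.
Proof.
move=> /zigzagP[x [y [t [Sx xy yt]]]] min_k.
have rk_x : zrank k.+1 x = k.
  have le_k : zrank k.+1 x <= k by apply: first_index_min Sx.
  apply/eqP; rewrite eqn_leq le_k leqNgt; apply/negP => lt_k.
  have Srk := @first_indexP (fun j => zreach j x) _ (leqW lt_k : zrank k.+1 x < k.+1).
  by have := min_k _ lt_k; rewrite (zreach_zigzag Srk xy yt).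
have rk_onto d : d <= k -> exists x' : vert G, zrank k.+1 x' = k - d.
  elim: d => [|d IHd] le_d; first by exists x; rewrite subn0.
  have [x' rk_x'] := IHd (ltnW le_d).
  by apply: (@zrank_pred _ _ _ x'); rewrite ?rk_x'; lia.
rewrite cardE -(size_map (zrank k.+1)) -[X in X <= _](size_iota 0).
apply: uniq_leq_size (iota_uniq 0 _) _ => i; rewrite mem_iota /= add0n ltnS => le_i.
have [|x' rk_x'] := rk_onto (k - i); first by rewrite leq_subr.
by apply/mapP; exists x'; rewrite ?mem_enum ?rk_x' ?subKn.
Qed.

Lemma zreach_seq (G : digraph) k (x : vert G) :
  zreach k x ->
  exists (w : vert G) (X Y : nat -> vert G),
    [/\ arc w (X 0), X k = x,
        forall i, i < k -> arc (X i) (Y i) & forall i, i < k -> arc (X i.+1) (Y i)].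
Proof.
elim: k x => [|k IHk] x /existsP[w].
  by exists w, (fun=> x), (fun=> x).
case/existsP=> y /and3P[/IHk[v [X [Y [vX Xk XY XSY]]]] wy xy].
exists v, (fun i => if i <= k then X i else x), (fun i => if i < k then Y i else y).
split=> [||i|i] //=; first by rewrite ltnn.
  by rewrite ltnS => le_i; rewrite le_i; case: ltngtP le_i => [/XY||->]; rewrite ?Xk.
by rewrite ltnS; case: ltngtP => // /XSY.
Qed.

(** * Levelled digraphs of height at most 3 *)

Definition has_levels (G : digraph) (lv : vert G -> nat) : Prop :=
  forall x y : vert G, arc x y -> lv y = (lv x).+1.

Lemma height3_hom_zigzag (T L : digraph) (lv : vert T -> nat) k :
  has_levels lv -> (forall x, lv x <= 3) -> (forall i, i < k -> ~~ zigzag T i) ->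
  zigzag L k -> hom_to T L.
Proof.
move=> lvP lv_le min_k /zigzagP[x [y [t [/zreach_seq[w [X [Y [wX Xk XY XSY]]]] xy yt]]]].
(* [Y] is controlled only below [k]; at the cutoff [k] the image must be the [y] that precedes
   [t]. *)
pose Y' i := if i < k then Y i else y.
exists (fun v => match lv v with
                 | 0 => w | 1 => X (zrank k v) | 2 => Y' (zrank_out k v) | _ => t
                 end) => u v uv.
have := lv_le v; rewrite (lvP _ _ uv).
case: (lv u) => [|[|[|//]]] _ /=.
- by rewrite (zrank0 k uv).
- rewrite /Y'; case: (zrank_arc k uv) => [->|[lt_k ->]]; last by rewrite lt_k XSY.
  case: ltnP => [/XY //|le_k]; have le_k' := first_index_le (fun i => zreach_out i v) k.
  by have -> : zrank_out k v = k by [apply/eqP; rewrite eqn_leq le_k' le_k]; rewrite Xk.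
(* A vertex of level 2 with an out-neighbour sits at the cutoff, since otherwise [T] would have a
   shorter zigzag. *)
- have -> : zrank_out k u = k; last by rewrite /Y' ltnn.
  apply: first_index_none => i lt_i; apply: contra (min_k _ lt_i) => Su.
  exact: zreach_out_zigzag Su uv.
Qed.

Lemma connect_closed_prop (V : finType) (e : rel V) (C : V -> Prop) :
  (forall u v, e u v -> C u -> C v) -> forall u v, connect e u v -> C u -> C v.
Proof.
move=> eC u v /connectP[p]; elim: p u => [|w p IHp] u /=; first by move=> _ ->.
by case/andP=> uw pw eq_v /(eC _ _ uw); apply: IHp.
Qed.

Lemma connected_has_arc (T : digraph) (u v : vert T) :
  connect (@uadj T) u v -> u != v -> exists x y : vert T, arc x y.
Proof.
move/connectP=> [[|w p] /= pP ->]; first by rewrite eqxx.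
by case/andP: pP => /orP[uw|wu] _ _; [exists u, w | exists w, u].
Qed.

Lemma height2_has_path (T : digraph) (lv : vert T -> nat) (u v : vert T) :
  has_levels lv -> connect (@uadj T) u v -> lv u = 0 -> lv v = 2 ->
  exists x y z : vert T, arc x y /\ arc y z.
Proof.
move=> lvP uv u0 v2.
(* Invariant along the walk from [u]: as long as no path is found, level 2 stays out of reach. *)
pose C (x : vert T) := (exists x y z : vert T, arc x y /\ arc y z) \/
  lv x = 0 \/ lv x = 1 /\ exists w : vert T, arc w x.
suff : C v by case=> [|[|[]]] //; rewrite v2.
apply: connect_closed_prop uv _; last by right; left.
move=> x y /orP[xy|yx] [?|Cx]; [by left| |by left|].
- have := lvP _ _ xy; case: Cx => [-> y1|[_ [w wx]] _].
    by right; right; split=> //; exists x.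
  by left; exists w, x, y.
- by right; left; have := lvP _ _ yx; case: Cx => [->|[-> _] []].
Qed.

Lemma height3_has_zigzag (T : digraph) (lv : vert T -> nat) (u v : vert T) :
  has_levels lv -> connect (@uadj T) u v -> lv u = 0 -> lv v = 3 ->
  exists k, zigzag T k.
Proof.
move=> lvP uv u0 v3.
(* Along the walk from [u], a step down to level 0 forgets the zigzag walk built so far, any other
   step starts or extends it, and a step up to level 3 completes a zigzag. *)
pose C (x : vert T) := (exists k, zigzag T k) \/
  [\/ lv x = 0, lv x = 1 /\ (exists k, zreach k x) | lv x = 2 /\ (exists k, zreach_out k x)].
suff : C v by case=> [|[|[]|[]]] //; rewrite v3.
apply: connect_closed_prop uv _; last by right; constructor 1.
move=> x y /orP[xy|yx] [?|Cx]; [by left| |by left|].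
- have := lvP _ _ xy; case: Cx => [-> y1|[-> [k Sx]] y2|[_ [k Sx]] _].
  + by right; constructor 2; split=> //; exists 0; apply/existsP; exists x.
  + by right; constructor 3; split=> //; exists k; apply: zreach_arc xy.
  + by left; exists k; apply: zreach_out_zigzag xy.
- have := lvP _ _ yx; case: Cx => [->|[-> _] [y0]|[-> [k Sx]] [y1]] //.
    by right; constructor 1.
  by right; constructor 2; split=> //; exists k.+1; apply: zreach_out_arc yx.
Qed.

(** * The dual of a zigzag *)

(* [(false, i)] stands for the vertices that are not sinks and [(true, i)] for
   the sinks; [i] is the truncated distance. *)
Definition zigzag_dual (k : nat) : digraph :=
  @Digraph (bool * 'I_k.+2)%type
    (fun p q => ~~ p.1 && (if q.1 then (p.2 == q.2 :> nat) || (p.2 == q.2.+1 :> nat)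
                           else (p.2 == k.+1 :> nat) && (q.2 == 0 :> nat))).

(** An arc into a non-sink ends at index [0], and passing through a sink raises the index by at most
    one. Passing through a non-sink would require index [k + 1], which [i <= k] excludes. *)
Lemma zigzag_dual_zreach k i (p q : vert (zigzag_dual k)) :
  i <= k -> zreach i p -> arc p q -> p.2 <= i.
Proof.
elim: i p q => [|i IHi] [b x] [c y] le_i /existsP[[b' x']] /=.
  by case: b => //= /andP[_ /andP[_ /eqP->]].
case/existsP=> -[c' y'] /and3P[Sx' x'y' xy'] _.
have {Sx'} /= := IHi _ _ (ltnW le_i) Sx' x'y'.
by move: x'y' xy' => /=; case: b'; case: b; case: c' => //= *; lia.
Qed.

Lemma zigzag_dual_no_zigzag k : ~~ zigzag (zigzag_dual k) k.
Proof.
apply/negP => /zigzagP[p [q [r [Sp pq qr]]]].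
(* The out-neighbour [r] makes [q] a non-sink, so the arc into [q] must start at index [k + 1]. *)
have := zigzag_dual_zreach (leqnn k) Sp pq.
by move: pq qr => /=; case: q.1; rewrite ?andbF //= => *; lia.
Qed.

Lemma no_zigzag_hom_dual (L : digraph) k : ~~ zigzag L k -> hom_to L (zigzag_dual k).
Proof.
move=> nz.
exists (fun x : vert L => if [exists y : vert L, arc x y]
          then (false, inord (zrank k.+1 x)) else (true, inord (zrank_out k.+1 x))) => x y xy.
have -> : [exists y : vert L, arc x y] by apply/existsP; exists y.
have le_x : zrank k.+1 x <= k.+1 := first_index_le _ _.
have le_y : zrank k.+1 y <= k.+1 := first_index_le _ _.
have le_out : zrank_out k.+1 y <= k.+1 := first_index_le _ _.
case: ifP => [/existsP[t yt]|_] /=; rewrite !inordK //.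
  (* Here [y] is not a sink: a distance of [x] below [k + 1] would give a zigzag ending with
     [y -> t]. *)
  rewrite (zrank0 _ xy) eqxx andbT; apply/eqP; apply: first_index_none => i.
  rewrite ltnS => le_i; apply: contra nz => Sx.
  exact: zigzag_leq le_i (zreach_zigzag Sx xy yt).
by case: (zrank_arc k.+1 xy) => [->|[_ ->]]; rewrite eqxx ?orbT.
Qed.

Lemma height3_duality (T : digraph) (lv : vert T -> nat) k :
  has_levels lv -> (forall x, lv x <= 3) -> zigzag T k ->
  (forall i, i < k -> ~~ zigzag T i) -> duality_pair T (zigzag_dual k).
Proof.
move=> lvP lv_le zT min_k L; split=> [nTL | LD TL].
  by apply: no_zigzag_hom_dual; apply/negP => /(height3_hom_zigzag lvP lv_le min_k).
by have := zigzag_dual_no_zigzag k; rewrite (zigzag_hom LD (zigzag_hom TL zT)).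
Qed.

(** * Heights 1 and 2, and the linear bound *)

Lemma height1_duality (T : digraph) (lv : vert T -> nat) :
  has_levels lv -> (forall x, lv x <= 1) -> (exists x y : vert T, arc x y) ->
  duality_pair T (@Digraph unit (fun _ _ => false)).
Proof.
move=> lvP lv_le [x [y xy]] L; split=> [nTL | [g gP] [f fP]]; last by have := gP _ _ (fP _ _ xy).
exists (fun=> tt) => a b ab; case: nTL.
exists (fun v => if lv v is 0 then a else b) => u v uv.
by have := lv_le v; rewrite (lvP _ _ uv); case: (lv u).
Qed.

(** A digraph without a directed walk of two arcs maps to a single arc: vertices with an
    in-neighbour go to its head, the others to its tail. *)
Lemma height2_duality (T : digraph) (lv : vert T -> nat) :
  has_levels lv -> (forall x, lv x <= 2) ->
  (exists x y z : vert T, arc x y /\ arc y z) ->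
  duality_pair T (@Digraph bool (fun a b => ~~ a && b)).
Proof.
move=> lvP lv_le [x [y [z [xy yz]]]] L; split=> [nTL | [g gP] [f fP]]; last first.
  have := gP _ _ (fP _ _ xy); have := gP _ _ (fP _ _ yz) => /=.
  by case: (g (f y)); rewrite ?andbF.
exists (fun v : vert L => [exists w : vert L, arc w v]) => a b ab /=.
apply/andP; split; last by apply/existsP; exists a.
apply/negP => /existsP[w wa]; case: nTL.
exists (fun v => match lv v with 0 => w | 1 => a | _ => b end) => u v uv.
by have := lv_le v; rewrite (lvP _ _ uv); case: (lv u) => [|[]].
Qed.

Theorem mainTheorem10 :
  exists c : nat,
    forall (T : digraph) (h : nat),
      oriented_tree T -> 1 <= h <= 3 -> has_height T h ->
      forall P : digraph, core_of P T ->
        exists D : digraph,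
          [/\ #|vert D| <= c * #|vert P|,
              #|vert D| <= c * #|vert T|
            & duality_pair T D].
Proof.
(* In height 3 the dual has [2 * (k + 2) <= 4 * (k + 1)] vertices, and [k + 1 <= #|vert P|]. *)
exists 4 => T h [_ _ _ conn _] h13 [lv [lvP [u u0] [v vh] lv_le]] P [_ [f [f_inj fP]] TP].
have PT : hom_to P T by exists f.
have le_PT : #|vert P| <= #|vert T| by apply: leq_card f_inj.
have P_gt0 : 0 < #|vert P| by case: TP => g _; apply/card_gt0P; exists (g u).
have uv := conn u v.
suff [D le_D dual_D] : exists2 D : digraph, #|vert D| <= 4 * #|vert P| & duality_pair T D.
  by exists D; split=> //; apply: leq_trans le_D _; rewrite leq_mul2l.
case: h => [|[|[|[|//]]]] // in h13 vh lv_le *.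
- exists (@Digraph unit (fun _ _ => false)); first by rewrite card_unit; lia.
  apply: (height1_duality lvP lv_le); apply: connected_has_arc uv _.
  by apply: contra_eq_neq vh => <-; rewrite u0.
- exists (@Digraph bool (fun a b => ~~ a && b)); first by rewrite card_bool; lia.
  exact: height2_duality lvP lv_le (height2_has_path lvP uv u0 vh).
- have exz := height3_has_zigzag lvP uv u0 vh.
  have [k zT min_z] := ex_minnP exz.
  have min_k i : i < k -> ~~ zigzag T i by apply: contraTN => /min_z; rewrite leqNgt.
  exists (zigzag_dual k); last exact: height3_duality lvP lv_le zT min_k.
  (* Being homomorphically equivalent, [P] and [T] have zigzags of the same indices, so [k] is
     minimal for [P] too. *)
  have : k < #|vert P|.
    apply: shortest_zigzag_card (zigzag_hom TP zT) _ => i /min_k.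
    by apply: contra; apply: zigzag_hom.
  by rewrite card_prod card_bool card_ord; lia.
Qed.
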